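(* Let $\mathcal{A}$ be a unital $C^*$-algebra and $a\in \mathcal{A}$. Then the following statements are equivalent: (i) $v(a)=\sqrt{\frac14 \| a^*a+aa^*\|}$. (ii) $\| Re(\lambda a) \|= \| Im(\lambda a)\|=\sqrt{\frac14 \| a^*a+aa^*\|}$ for all $\lambda\in\mathbb{C}$ with $|\lambda|=1$. (iii) $\| Re(\lambda a) + Im(\lambda a)\|=\| Re(\lambda a) - Im(\lambda a)\|=\sqrt{\frac12 \| a^*a+aa^*\|}$ for all $\lambda\in\mathbb{C}$ with $|\lambda|=1$. (iv) With $k=\frac12\|a^*a+aa^*\|^{1/2}$, there is a semi-circular disk $\mathbb{S}_k$ with center at the origin and radius $k$ such that $\mathbb{S}_{k} \subseteq V(a) \subseteq \mathbb{D}_{k}$.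
   Context: $\mathcal{A}$ is a unital $C^*$-algebra with unit $e$. $S(\mathcal{A})$ is the set of normalized states, i.e. continuous linear functionals $f$ on $\mathcal{A}$ with $f(e)=\|f\|=1$. The algebraic numerical range of $a$ is $V(a)=\{f(a): f\in S(\mathcal{A})\}\subseteq\mathbb{C}$ and the algebraic numerical radius is $v(a)=\sup\{|f(a)|: f\in S(\mathcal{A})\}$. $Re(a)=\frac12(a+a^* )$ and $Im(a)=\frac{1}{2i}(a-a^* )$. $\mathbb{D}_k=\{z\in\mathbb{C}:|z|\le k\}$ is the circular disk with center at the origin and radius $k$. A semi-circular disk with center at the origin and radius $k$ is a closed half of $\mathbb{D}_k$ cut off by a diameter, i.e. a set $\{z\in\mathbb{C}: |z|\le k,\ \mathrm{Re}(e^{i\theta}z)\ge 0\}$ for some $\theta\in\mathbb{R}$. *)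

(* Defs.v *)
From HB Require Import structures.
From mathcomp Require Import all_boot all_order all_algebra.
From mathcomp Require Import complex.
From mathcomp Require Import all_classical all_reals all_analysis.

Set Implicit Arguments.
Unset Strict Implicit.
Unset Printing Implicit Defensive.

Import Order.TTheory GRing.Theory Num.Theory.
Import numFieldNormedType.Exports.

Local Open Scope classical_set_scope.
Local Open Scope complex_scope.
Local Open Scope ring_scope.

(* normedModType R[i] and algType R[i] cannot be joined: numDomainType is
   already above both a ring and a normed Z-module. Hence the norm is a field
   of a structure over algType, and the topology lives on the alias
   [normed_space A] of A. *)
HB.mixin Record isNormedAlgebra (R : realType) A & GRing.Algebra R[i] A := {
  cnorm : A -> R;
  cnormD : forall x y : A, cnorm (x + y) <= cnorm x + cnorm y;
  cnormZ : forall (l : R[i]) (x : A), cnorm (l *: x) = complex.Re `|l| * cnorm x;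
  cnorm0_eq0 : forall x : A, cnorm x = 0 -> x = 0;
  cnormM : forall x y : A, cnorm (x * y) <= cnorm x * cnorm y
}.

#[short(type="normedAlgType")]
HB.structure Definition NormedAlgebra (R : realType) :=
  {A of GRing.Algebra R[i] A & isNormedAlgebra R A}.

Definition normed_space (R : realType) (A : normedAlgType R) : Type := A.

Section NormedSpace.
Variables (R : realType) (A : normedAlgType R).

HB.instance Definition _ := GRing.Lmodule.copy (normed_space A) A.

Let norm (x : normed_space A) : R[i] := (cnorm (x : A))%:C.

Let ler_normD x y : norm (x + y) <= norm x + norm y.
Proof. by rewrite /norm -rmorphD lecR; exact: (@cnormD R A). Qed.

Let normrZ (l : R[i]) x : norm (l *: x) = `|l| * norm x.
Proof. by rewrite /norm [cnorm _](@cnormZ R A) rmorphM; congr (_ * _). Qed.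

Let normr0_eq0 x : norm x = 0 -> x = 0.
Proof. by move=> /complexI; exact: (@cnorm0_eq0 R A). Qed.

HB.instance Definition _ := Lmodule_isNormed.Build R[i] (normed_space A)
  ler_normD normrZ normr0_eq0.

End NormedSpace.

(* Unital: the unit and 1 != 0 come from algType. The zero algebra, which has
   no normalized states, is thus excluded. *)
HB.mixin Record isCStarAlgebra (R : realType) A & NormedAlgebra R A := {
  star : A -> A;
  starD : forall x y : A, star (x + y) = star x + star y;
  starZ : forall (l : R[i]) (x : A), star (l *: x) = conjc l *: star x;
  starM : forall x y : A, star (x * y) = star y * star x;
  starK : forall x : A, star (star x) = x;
  cstar_identity : forall x : A, cnorm (star x * x) = cnorm x ^+ 2;
  cstar_complete : forall F : set_system (normed_space A),
    ProperFilter F -> cauchy F -> cvg F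
}.

#[short(type="cstarAlgType")]
HB.structure Definition CStarAlgebra (R : realType) :=
  {A of NormedAlgebra R A & isCStarAlgebra R A}.

HB.instance Definition _ (R : realType) (A : cstarAlgType R) :=
  Uniform_isComplete.Build (normed_space A) (@cstar_complete R A).

Section NumericalRange.
Variables (R : realType) (A : cstarAlgType R).
Implicit Types (a : A) (f : {scalar A}).

Definition cstar_Re a : A := 2^-1 *: (a + star a).
Definition cstar_Im a : A := (2 * 'i)^-1 *: (a - star a).

(* The modulus on R[i] takes values in R[i], whence complex.Re. The sup is a
   genuine one when f is continuous. *)
Definition dual_norm f : R :=
  sup [set complex.Re `|f x| | x in [set x : A | cnorm x <= 1]].

Definition normalized_state : set {scalar A} :=
  [set f : {scalar A} | [/\ continuous (f : normed_space A -> R[i]^o),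
               f 1 = 1 & dual_norm f = 1]].

Definition num_range a : set R[i] := [set f a | f in normalized_state].

Definition num_radius a : R :=
  sup [set complex.Re `|f a| | f in normalized_state].

End NumericalRange.

Definition disk (R : realType) (k : R) : set R[i] := [set z | `|z| <= k%:C].

(* cos t +i* sin t is e^{it}. *)
Definition semidisk (R : realType) (t k : R) : set R[i] :=
  [set z | `|z| <= k%:C /\ 0 <= complex.Re ((cos t +i* sin t) * z)].

(* Main.v *)
Require Import Defs.
From HB Require Import structures.
From mathcomp Require Import all_boot all_order all_algebra.
From mathcomp Require Import complex.
From mathcomp Require Import all_classical all_reals all_analysis.
From mathcomp Require Import ring lra.

Set Implicit Arguments.
Unset Strict Implicit.
Unset Printing Implicit Defensive.

Import Order.TTheory GRing.Theory Num.Theory.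
Import numFieldNormedType.Exports.

Local Open Scope classical_set_scope.
Local Open Scope complex_scope.
Local Open Scope ring_scope.

(** Write [h_l] for the real part of [l a], [|l| = 1], and [k] for half the
    square root of [|a^* a + a a^*|]. The numerical radius of [a] is the supremum
    of the [|h_l|], and [|h_l^2 + h_(il)^2| = 2 k^2] for all [l]; so (i) amounts to
    [|h_l| = k] for all [l], and (iii) is the same condition at the rotated
    points [exp (i pi / 4) l] and [exp (- i pi / 4) l].

    For (iv), let [f0] be a state norming [h_l^2 + h_(il)^2], which does not depend
    on [l]. Then [f0 (h_l^2) = k^2] for all [l]. If [k] is not a value of the states
    at [h_l], positivity of squares yields [f0 (h_l) = - k], that is
    [l f0 (a) = - k]. Hence all points of the circle of radius [k] but at most one
    lie in the numerical range, and convexity gives a half disk.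

    A self-adjoint [h] is normed by a state because [|1 + h| = 1 + |h|] or
    [|1 - h| = 1 + |h|]: a functional norming [1 + h] or [1 - h] is a state. *)

(** * Norms in a normed algebra, up to Cauchy's estimate for coefficients *)

Section NormedAlgebraTheory.
Variables (R : realType) (A : normedAlgType R).
Implicit Types (x y : A) (r : R).

Lemma cnormZr r x : cnorm (r%:C *: x) = `|r| * cnorm x.
Proof. by rewrite cnormZ normc_def /= expr0n addr0 sqrtr_sqr. Qed.

Lemma cnormZ1 (z : R[i]) x : `|z| = 1 -> cnorm (z *: x) = cnorm x.
Proof. by rewrite cnormZ => ->; rewrite mul1r. Qed.

Lemma cnorm0 : cnorm (0 : A) = 0.
Proof. by rewrite -(scale0r (0 : A)) -(raddf0 (real_complex R)) cnormZr normr0 mul0r. Qed.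

Lemma cnormN x : cnorm (- x) = cnorm x.
Proof. by rewrite -scaleN1r cnormZ1 // normrN1. Qed.

Lemma cnorm_ge0 x : 0 <= cnorm x.
Proof.
have := cnormD x (- x); rewrite subrr cnorm0 cnormN -mulr2n.
by rewrite pmulrn_lge0.
Qed.

Lemma cnormB x y : cnorm (x - y) <= cnorm x + cnorm y.
Proof. by rewrite -(cnormN y) cnormD. Qed.

Lemma cnorm1_gt0 : 0 < cnorm (1 : A).
Proof.
rewrite lt_def cnorm_ge0 andbT; apply/eqP => /cnorm0_eq0/eqP.
by rewrite oner_eq0.
Qed.

Lemma cnormX x n : cnorm (x ^+ n.+1) <= cnorm x ^+ n.+1.
Proof.
elim: n => [|n IHn]; first by rewrite !expr1.
rewrite exprS [leRHS]exprS; apply: (le_trans (cnormM _ _)).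
by rewrite ler_wpM2l // cnorm_ge0.
Qed.

Lemma cnormMn x n : cnorm (x *+ n) = cnorm x *+ n.
Proof.
rewrite -scaler_nat -(rmorph_nat (real_complex R)) cnormZr.
by rewrite ger0_norm // mulr_natl.
Qed.

(* Cauchy's estimate for the polynomial [sum_j z^j c_j]. Averaging over
   [z] and [-z] separates the even and the odd part, which are polynomials of
   half the length in [z^2]. *)
Lemma cauchy_estimate m (c : nat -> A) (M : R) :
  (forall z : R[i], `|z| = 1 ->
     cnorm (\sum_(j < 2 ^ m) z ^+ j *: c j) <= M) ->
  forall j, (j < 2 ^ m)%N -> cnorm (c j) <= M.
Proof.
have root2 (z : R[i]) : `|z| = 1 -> exists2 w, `|w| = 1 & w ^+ 2 = z.
  move=> z1; exists (sqrtC z); last exact: sqrtCK.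
  apply/eqP; rewrite -(@eqrXn2 _ 2) // expr1n -normrX sqrtCK z1.
  by [].
have half (x y : A) : cnorm (x + y) <= M -> cnorm (x - y) <= M ->
    cnorm x <= M /\ cnorm y <= M.
  move=> xy yx; have e (u : A) : cnorm (u *+ 2) <= 2 * M -> cnorm u <= M.
    by rewrite cnormMn => uM; lra.
  split; apply: e.
    have -> : x *+ 2 = (x + y) + (x - y) by rewrite addrACA subrr addr0 -mulr2n.
    by apply: (le_trans (cnormD _ _)); lra.
  have -> : y *+ 2 = (x + y) - (x - y).
    by rewrite opprB [x + y]addrC addrACA subrr addr0 -mulr2n.
  by apply: (le_trans (cnormB _ _)); lra.
elim: m c => [|m IHm] c cM j.
  rewrite expn0 ltnS leqn0 => /eqP ->.
  by have := cM 1 (normr1 _); rewrite big_ord1 expr0 scale1r.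
have splitE (z : R[i]) : \sum_(j < 2 ^ m.+1) z ^+ j *: c j =
    \sum_(j < 2 ^ m) (z ^+ 2) ^+ j *: c j.*2
    + z *: \sum_(j < 2 ^ m) (z ^+ 2) ^+ j *: c j.*2.+1.
  rewrite expnS mul2n; elim: (2 ^ m)%N => [|k IHk].
    by rewrite !big_ord0 scaler0 addr0.
  rewrite doubleS !big_ord_recr /= IHk scalerDr -exprM mul2n.
  rewrite scalerA -exprS -!addrA; congr (_ + _).
  by rewrite addrCA.
have eo (w : R[i]) : `|w| = 1 ->
    cnorm (\sum_(j < 2 ^ m) w ^+ j *: c j.*2) <= M /\
    cnorm (\sum_(j < 2 ^ m) w ^+ j *: c j.*2.+1) <= M.
  move=> /root2[z z1 <-].
  rewrite -(@cnormZ1 z (\sum_(j < 2 ^ m) _ *: c j.*2.+1)) //.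
  apply: half; first by rewrite -splitE cM.
  have := cM (- z); rewrite normrN => /(_ z1).
  by rewrite splitE sqrrN scaleNr.
move=> jm; rewrite -(odd_double_half j).
have jm2 : (j./2 < 2 ^ m)%N.
  by rewrite -ltn_double -(mul2n (2 ^ m)) -expnS (leq_ltn_trans _ jm) //
     -{2}(odd_double_half j) leq_addl.
case: (odd j).
  by apply: (IHm (fun j => c j.*2.+1)) => // w /eo[].
by apply: (IHm (fun j => c j.*2)) => // w /eo[].
Qed.

End NormedAlgebraTheory.

(** With [y / x = (1 + e) ^+ 2] and [n = 2 ^ m - 1], Bernoulli's inequality gives
    [(y / x) ^+ n >= (1 + n e) ^+ 2], which exceeds [n + 1] once [n e ^+ 2 > 1]. The exponent is the
    degree of a polynomial with [2 ^ m] coefficients. *)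
Lemma exists_expr_gt_pow2 (R : realType) (x y : R) : 0 < x < y ->
  exists m, (2 ^ m)%:R * x ^+ (2 ^ m).-1 < y ^+ (2 ^ m).-1.
Proof.
move=> /andP[x0 xy]; pose e := Num.sqrt (y / x) - 1.
have e0 : 0 < e.
  by rewrite subr_gt0 -sqrtr1 ltr_sqrt ?divr_gt0 ?ltr_pdivlMr ?mul1r // (lt_trans x0).
have yE : y = (1 + e) ^+ 2 * x.
  by rewrite addrC subrK sqr_sqrtr ?divr_ge0 ?divfK // ?gt_eqF // ltW // (lt_trans x0).
have bernoulli n : 1 + n%:R * e <= (1 + e) ^+ n.
  elim: n => [|n IHn]; first by rewrite mul0r addr0 expr0.
  have n0 : 0 <= n%:R * e by rewrite mulr_ge0 // ltW.
  rewrite exprS -natr1; apply: (@le_trans _ _ ((1 + e) * (1 + n%:R * e))); first nra.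
  by rewrite ler_wpM2l //; lra.
have [m me] : exists m : nat, (e ^+ 2)^-1 < m%:R.
  by eexists; apply: archi_boundP; rewrite invr_ge0 sqr_ge0.
exists m; set n := (2 ^ m).-1.
have nE : (2 ^ m)%:R = 1 + n%:R :> R.
  by rewrite addrC natr1 /n prednK // expn_gt0.
have ne : 1 < n%:R * e ^+ 2.
  rewrite -ltr_pdivrMr ?exprn_gt0 // div1r (lt_le_trans me) // ler_nat.
  by rewrite /n -ltnS prednK ?expn_gt0 // ltn_expl.
have n1 : 0 < n%:R :> R by case: (n) ne => [|//]; rewrite mul0r ltr10.
rewrite nE yE exprMn ltr_pM2r ?exprn_gt0 // exprAC.
have ne0 : 0 < n%:R * e by rewrite mulr_gt0.
apply: (@lt_le_trans _ _ ((1 + n%:R * e) ^+ 2)).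
  have : n%:R < (n%:R * e) ^+ 2.
    by rewrite exprMn expr2 -mulrA -[ltLHS]mulr1 ltr_pM2l.
  nra.
by rewrite lerXn2r ?nnegrE //; have := bernoulli n; lra.
Qed.

(** * Consequences of the C*-identity for self-adjoint elements *)

Section StarTheory.
Variables (R : realType) (A : cstarAlgType R).
Implicit Types (x y h : A) (r : R).

Definition selfadjoint x := star x = x.

Lemma starZr r x : star (r%:C *: x) = r%:C *: star x.
Proof. by rewrite starZ conjc_real. Qed.

Lemma starN x : star (- x) = - star x.
Proof.
rewrite -scaleN1r -(rmorph1 (real_complex R)) -rmorphN starZr.
by rewrite rmorphN rmorph1 scaleN1r.
Qed.

Lemma selfadjoint1 : selfadjoint 1.
Proof. by rewrite /selfadjoint -[LHS]mul1r -{1}(starK 1) -starM mul1r starK. Qed.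

Lemma selfadjointD x y : selfadjoint x -> selfadjoint y -> selfadjoint (x + y).
Proof. by rewrite /selfadjoint starD => -> ->. Qed.

Lemma selfadjointN x : selfadjoint x -> selfadjoint (- x).
Proof. by rewrite /selfadjoint starN => ->. Qed.

Lemma selfadjointB x y : selfadjoint x -> selfadjoint y -> selfadjoint (x - y).
Proof. by move=> *; apply: selfadjointD => //; exact: selfadjointN. Qed.

Lemma selfadjointZ r x : selfadjoint x -> selfadjoint (r%:C *: x).
Proof. by rewrite /selfadjoint starZr => ->. Qed.

Lemma selfadjointX x n : selfadjoint x -> selfadjoint (x ^+ n).
Proof.
move=> sx; elim: n => [|n IHn]; first exact: selfadjoint1.
by rewrite /selfadjoint exprS starM sx IHn -exprSr exprS.
Qed.

Lemma cnorm_star x : cnorm (star x) = cnorm x.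
Proof.
have le y : cnorm y <= cnorm (star y).
  have [->|y0] := eqVneq (cnorm y) 0; first exact: cnorm_ge0.
  have y1 : 0 < cnorm y by rewrite lt_def y0 cnorm_ge0.
  by rewrite -(ler_pM2r y1) -expr2 -cstar_identity cnormM.
by apply/eqP; rewrite eq_le le -{2}(starK x) le.
Qed.

Lemma cnorm_sqr h : selfadjoint h -> cnorm (h ^+ 2) = cnorm h ^+ 2.
Proof. by move=> sh; rewrite -cstar_identity sh expr2. Qed.

Lemma cnorm1 : cnorm (1 : A) = 1.
Proof.
apply: (mulfI (lt0r_neq0 (cnorm1_gt0 A))).
by rewrite mulr1 -expr2 -(cnorm_sqr selfadjoint1) expr1n.
Qed.

Lemma cnormX_le x n : cnorm (x ^+ n) <= cnorm x ^+ n.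
Proof. by case: n => [|n]; rewrite ?expr0 ?cnorm1 // cnormX. Qed.

(** Iterating the C*-identity settles the powers of two. For general [n],
    [|h|^(2^n) <= |h^n| |h|^(2^n - n)], and the last factor cancels. *)
Lemma cnormX_selfadjoint h n : selfadjoint h -> cnorm (h ^+ n) = cnorm h ^+ n.
Proof.
move=> sh; have pow2 m : cnorm (h ^+ (2 ^ m)) = cnorm h ^+ (2 ^ m).
  elim: m => [|m IHm]; first by rewrite !expn0 !expr1.
  rewrite expnSr !exprM cnorm_sqr ?IHm //.
  exact: selfadjointX.
have [h0|h0] := eqVneq (cnorm h) 0.
  case: n => [|n]; first by rewrite !expr0 cnorm1.
  by rewrite (cnorm0_eq0 _ h0) expr0n cnorm0 expr0n.
have h1 : 0 < cnorm h by rewrite lt_def h0 cnorm_ge0.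
apply/eqP; rewrite eq_le cnormX_le /=.
have n2 : (n <= 2 ^ n)%N by rewrite ltnW // ltn_expl.
rewrite -(ler_pM2r (exprn_gt0 (2 ^ n - n) h1)) -exprD subnKC //.
rewrite -pow2 -{1}(subnKC n2) exprD (le_trans (cnormM _ _)) //.
by rewrite ler_wpM2l ?cnorm_ge0 // cnormX_le.
Qed.

Lemma star_cartesian x y : selfadjoint x -> selfadjoint y ->
  star (x + 'i *: y) = x - 'i *: y.
Proof.
move=> sx sy; rewrite starD starZ sx sy -scaleNr; congr (_ + _ *: _).
exact: conjCi.
Qed.

(** By commutation, [(x - i y) (x + i y) = x^2 + y^2]. *)
Lemma cnorm_cartesian x y : selfadjoint x -> selfadjoint y -> GRing.comm x y ->
  cnorm (x + 'i *: y) ^+ 2 = cnorm (x ^+ 2 + y ^+ 2).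
Proof.
move=> sx sy xy; rewrite -cstar_identity star_cartesian //; congr cnorm.
rewrite mulrDr !mulrBl -!scalerAr -!scalerAl -xy scalerA.
rewrite -[_ * 'i]expr2 sqrCi scaleN1r -!expr2 opprK.
by rewrite addrA subrK.
Qed.

Lemma cnorm_cartesian_le x y :
  selfadjoint x -> selfadjoint y -> GRing.comm x y ->
  cnorm (x + 'i *: y) ^+ 2 <= cnorm x ^+ 2 + cnorm y ^+ 2.
Proof.
by move=> sx sy xy; rewrite cnorm_cartesian // -!cnorm_sqr // cnormD.
Qed.

(* If both fail, then [1 + z h] has norm at most some [M < 1 + |h|] for all
   unimodular [z], and Cauchy's estimate for [(1 + z h)^n] bounds each of the
   [n + 1] terms of the binomial expansion of [(1 + |h|)^n] by [M^n]. *)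
Lemma cnorm_1D_selfadjoint h : selfadjoint h ->
  cnorm (1 + h) = 1 + cnorm h \/ cnorm (1 - h) = 1 + cnorm h.
Proof.
move=> sh; set b := cnorm h; have b0 : 0 <= b := cnorm_ge0 h.
apply: contrapT => /not_orP[/eqP p /eqP m].
have {}p : cnorm (1 + h) < 1 + b by rewrite lt_neqAle p -cnorm1 cnormD.
have {}m : cnorm (1 - h) < 1 + b by rewrite lt_neqAle m -cnorm1 cnormB.
have [u /andP[u0 ub] [pu mu]] : exists2 u, 0 <= u < b &
    cnorm (1 + h) <= 1 + u /\ cnorm (1 - h) <= 1 + u.
  have b1 : 0 < b.
    rewrite lt_def b0 andbT; apply/eqP => b00; move: p.
    by rewrite b00 (cnorm0_eq0 _ b00) !addr0 cnorm1 ltxx.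
  exists (Num.max 0 (Num.max (cnorm (1 + h)) (cnorm (1 - h)) - 1)).
    by rewrite le_max lexx /= !gt_max b1 /= ltrBlDl gt_max p m.
  by split; rewrite -lerBlDl !le_max lerD2r le_max lexx ?orbT.
(* For [z = c + i d] of modulus 1 and [v = |c|], the Cartesian bound gives [|1 + z h|^2 <= (1 + v
   u)^2 + (1 - v^2) b^2 <= 1 + 2 u + b^2], which is below [(1 + b)^2] because [u < b]. *)
pose M := Num.sqrt (1 + 2 * u + b ^+ 2).
have M2 : M ^+ 2 = 1 + 2 * u + b ^+ 2 by rewrite sqr_sqrtr //; nra.
have M0 : 0 < M by rewrite sqrtr_gt0; nra.
have Mb : M < 1 + b by rewrite -(@ltr_pXn2r _ 2) ?nnegrE ?M2 //; nra.
(* For [0 <= d <= 1], [1 + d y] is a convex combination of [1] and [1 + y]; this is used with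
   [y = h] and [y = - h]. *)
have real_le c : `|c| <= 1 -> cnorm (1 + c%:C *: h) <= 1 + `|c| * u.
  move=> c1; have key d : 0 <= d <= 1 -> forall y, cnorm (1 + y) <= 1 + u ->
      cnorm (1 + d%:C *: y) <= 1 + d * u.
    move=> /andP[d0 d1] y yu.
    have -> : 1 + d%:C *: y = (1 - d)%:C *: 1 + d%:C *: (1 + y).
      by rewrite scalerDr rmorphB scalerBl scale1r addrA subrK.
    apply: (le_trans (cnormD _ _)); rewrite !cnormZr cnorm1.
    rewrite !ger0_norm //; last lra.
    nra.
  have [c0|c0] := lerP 0 c.
    by rewrite (ger0_norm c0) in c1 *; apply: key => //; rewrite c0.
  have -> : c%:C *: h = (- c)%:C *: (- h) by rewrite rmorphN scaleNr scalerN opprK.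
  by rewrite (ltr0_norm c0) in c1 *; apply: key => //; lra.
have unit_le (z : R[i]) : `|z| = 1 -> cnorm (1 + z *: h) <= M.
  case: z => c d; rewrite normc_def /= => /complexI z1.
  have {}z1 : c ^+ 2 + d ^+ 2 = 1.
    by rewrite -[LHS]sqr_sqrtr ?z1 ?expr1n // addr_ge0 // sqr_ge0.
  have c1 : `|c| <= 1.
    by rewrite -(@ler_pXn2r _ 2) ?nnegrE // real_normK ?num_real //; nra.
  rewrite -(@ler_pXn2r _ 2) ?nnegrE ?cnorm_ge0 ?(ltW M0) // M2.
  have -> : 1 + (c +i* d) *: h = 1 + c%:C *: h + 'i *: (d%:C *: h).
    rewrite -addrA scalerA -scalerDl; congr (_ + _ *: _).
    exact: (complexE (c +i* d)).
  apply: (le_trans (cnorm_cartesian_le _ _ _)).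
  - by apply: selfadjointD; [exact: selfadjoint1 | exact: selfadjointZ].
  - exact: selfadjointZ.
  - rewrite /GRing.comm mulrDl mulrDr mul1r mulr1; congr (_ + _).
    by rewrite -!scalerAl -!scalerAr !scalerA mulrC.
  rewrite cnormZr exprMn real_normK ?num_real //.
  have := real_le _ c1; have := cnorm_ge0 (1 + c%:C *: h).
  have : 0 <= `|c| by [].
  have : `|c| ^+ 2 = c ^+ 2 by rewrite real_normK ?num_real.
  rewrite -/b; set v := `|c| in c1 *; set w := cnorm _ => vc v0 w0 wv.
  apply: (@le_trans _ _ ((1 + v * u) ^+ 2 + d ^+ 2 * b ^+ 2)).
    by rewrite lerD2r lerXn2r ?nnegrE //; nra.
  have -> : d ^+ 2 = 1 - v ^+ 2 by lra.
  have : u ^+ 2 <= b ^+ 2 by nra.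
  have : 0 <= u * (1 - v) by nra.
  have := sqr_ge0 v.
  nra.
have [k kM] : exists k, (2 ^ k)%:R * M ^+ (2 ^ k).-1 < (1 + b) ^+ (2 ^ k).-1.
  by apply: exists_expr_gt_pow2; rewrite M0.
(* With [n = 2 ^ k - 1], the polynomial [(1 + z h)^n] has exactly the [2 ^ k] coefficients that
   [cauchy_estimate] handles. *)
move: kM; apply/negP; rewrite -leNgt; set n := (2 ^ k).-1.
have nE : (2 ^ k)%N = n.+1 by rewrite prednK // expn_gt0.
have coef j : (j < n.+1)%N -> b ^+ j *+ 'C(n, j) <= M ^+ n.
  rewrite -nE => jn; rewrite -cnormX_selfadjoint // -cnormMn.
  apply: (cauchy_estimate (c := fun j => h ^+ j *+ 'C(n, j)) _ jn) => z z1.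
  have -> : \sum_(i < 2 ^ k) z ^+ i *: (h ^+ i *+ 'C(n, i)) = (1 + z *: h) ^+ n.
    rewrite nE [1 + _]addrC exprD1n; apply: eq_bigr => i _.
    by rewrite exprZn scalerMnr.
  apply: (le_trans (cnormX_le _ _)).
  by rewrite lerXn2r ?nnegrE ?cnorm_ge0 ?(ltW M0) ?unit_le.
rewrite [1 + b]addrC exprD1n.
apply: (le_trans (ler_sum _ (fun (i : 'I_n.+1) _ => coef i (ltn_ord i)))).
by rewrite sumr_const card_ord nE mulr_natl.
Qed.

End StarTheory.

(** * The Hahn-Banach theorem for sublinear functionals *)

Section Sublinear.
Variables (R : realType) (V : lmodType R[i]).
Implicit Types (p q : V -> R) (x y z : V) (t : R).

Definition sublinear p :=
  (forall x y, p (x + y) <= p x + p y) /\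
  (forall t x, 0 <= t -> p (t%:C *: x) <= t * p x).

Lemma sublinear0 p : sublinear p -> p 0 = 0.
Proof.
move=> [pD pZ]; apply/eqP; rewrite eq_le; apply/andP; split.
  by have := pZ 0 0 (lexx 0); rewrite scaler0 mul0r.
by have := pD 0 0; rewrite addr0; lra.
Qed.

Lemma sublinearN_ge p x : sublinear p -> - p (- x) <= p x.
Proof.
move=> sp; have := sp.1 x (- x); rewrite subrr sublinear0 //; lra.
Qed.

Lemma sublinearZ p t x : sublinear p -> 0 <= t -> p (t%:C *: x) = t * p x.
Proof.
move=> sp t0; apply/eqP; rewrite eq_le sp.2 //=.
have [->|tn0] := eqVneq t 0; first by rewrite raddf0 scale0r sublinear0 // mul0r.
have {tn0}t0 : 0 < t by rewrite lt_def tn0.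
rewrite -ler_pdivlMl //; apply: le_trans (sp.2 _ _ _); last by rewrite invr_ge0 ltW.
by rewrite scalerA -rmorphM mulVf ?gt_eqF // rmorph1 scale1r.
Qed.

(** The index [k] may depend on [x] and [y]. This covers both the infimum over [t] in [descent] and
    the infimum of a chain, where [k] is the smaller of two functionals. *)
Lemma sublinear_inf (I : Type) (D : set I) (F : I -> V -> R) :
  D !=set0 -> (forall x, has_lbound [set F i x | i in D]) ->
  (forall i j x y, D i -> D j ->
     exists2 k, D k & F k (x + y) <= F i x + F j y) ->
  (forall i t x, D i -> 0 <= t -> exists2 k, D k & F k (t%:C *: x) <= t * F i x) ->
  sublinear (fun x => inf [set F i x | i in D]).
Proof.
move=> [i0 Di0] lb FD FZ.
have ge0inf r x : (forall i, D i -> r <= F i x) -> r <= inf [set F i x | i in D].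
  move=> rF; apply: lb_le_inf; first by exists (F i0 x), i0.
  by move=> _ [i Di <-]; exact: rF.
have infle i x : D i -> inf [set F i x | i in D] <= F i x.
  by move=> Di; apply: ge_inf => //; exists i.
split=> [x y|t x].
  rewrite -lerBlDr; apply: (ge0inf) => i Di; rewrite lerBlDr -lerBlDl.
  apply: (ge0inf) => j Dj; rewrite lerBlDl.
  by have [k Dk /(le_trans (infle _ _ Dk))] := FD i j x y Di Dj.
have le i : D i -> 0 <= t -> inf [set F i (t%:C *: x) | i in D] <= t * F i x.
  by move=> Di t0; have [k Dk /(le_trans (infle _ _ Dk))] := FZ i t x Di t0.
move=> t0; have [t00|tn0] := eqVneq t 0.
  by have := le _ Di0 t0; rewrite t00 !mul0r.
have {tn0}t1 : 0 < t by rewrite lt_def tn0.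
by rewrite -ler_pdivrMl //; apply: (ge0inf) => i Di; rewrite ler_pdivrMl // le.
Qed.

(** For sublinear [p], this is the largest sublinear functional below [p] whose value at [- z] is at
    most [- p z]. *)
Definition descent p z x := inf [set p (x + t%:C *: z) - t * p z | t in [set t | 0 <= t]].

Lemma descent_lb p z x : sublinear p ->
  has_lbound [set p (x + t%:C *: z) - t * p z | t in [set t | 0 <= t]].
Proof.
move=> sp; exists (- p (- x)) => _ [t t0 <-].
have := sp.1 (x + t%:C *: z) (- x); rewrite addrAC subrr add0r sublinearZ //.
by lra.
Qed.

Lemma descent_le p z x t : sublinear p -> 0 <= t ->
  descent p z x <= p (x + t%:C *: z) - t * p z.
Proof. by move=> sp t0; apply: ge_inf; [exact: descent_lb | exists t]. Qed.

Lemma descent_sublinear p z : sublinear p -> sublinear (descent p z).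
Proof.
move=> sp; apply: sublinear_inf.
- by exists 0 => /=.
- by move=> x; exact: descent_lb.
- move=> s t x y s0 t0; exists (s + t); first exact: addr_ge0.
  have := sp.1 (x + s%:C *: z) (y + t%:C *: z).
  by rewrite addrACA -scalerDl -rmorphD mulrDl; lra.
- move=> s t x s0 t0; exists (t * s); first exact: mulr_ge0.
  by rewrite rmorphM -scalerA -scalerDr sublinearZ //; lra.
Qed.

(** Zorn's lemma for the reversed pointwise order. Infima along a chain are finite, since every
    member satisfies [q x >= - q (- x) >= - p0 (- x)]. *)
Lemma sublinear_minimal p0 : sublinear p0 ->
  exists p, [/\ sublinear p, forall x, p x <= p0 x &
    forall q, sublinear q -> (forall x, q x <= p x) -> q = p].
Proof.
move=> sp0; pose P p := sublinear p /\ forall x, p x <= p0 x; pose T := {p | P p}.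
pose ge (p q : T) := `[< forall x, sval q x <= sval p x >].
have [||||[p [sp pp0]] pmin] := @Zorn T ge.
- by move=> p; apply/asboolP.
- move=> p q r /asboolP qp /asboolP rq; apply/asboolP => x.
  exact: le_trans (rq x) (qp x).
- move=> [p sp] [q sq] /asboolP/= qp /asboolP/= pq; apply: eq_exist.
  by apply/funext => x; apply/eqP; rewrite eq_le pq qp.
- move=> D Dtot; have [->|/set0P[q0 Dq0]] := eqVneq D set0.
    by exists (exist P p0 (conj sp0 (fun=> lexx _))).
  have lb x : has_lbound [set sval q x | q in D].
    exists (- p0 (- x)) => _ [[q [sq qp0]] _ <-] /=.
    by apply: le_trans (sublinearN_ge x sq); rewrite lerN2.
  have sq : sublinear (fun x => inf [set sval q x | q in D]).
    apply: sublinear_inf => //; first by exists q0.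
      move=> q r x y Dq Dr; have [/asboolP rq|/asboolP qr] := Dtot _ _ Dq Dr.
        exists r => //; apply: (le_trans ((svalP r).1.1 x y)).
        by rewrite lerD2r.
      exists q => //; apply: (le_trans ((svalP q).1.1 x y)).
      by rewrite lerD2l.
    by move=> q t x Dq t0; exists q => //; exact: (svalP q).1.2.
  have infle (q : T) x : D q -> inf [set sval q x | q in D] <= sval q x.
    by move=> Dq; apply: ge_inf => //; exists q.
  have qp0 x : inf [set sval q x | q in D] <= p0 x.
    exact: le_trans (infle _ _ Dq0) ((svalP q0).2 x).
  exists (exist P _ (conj sq qp0)) => r Dr; apply/asboolP => x /=.
  exact: infle.
exists p; split=> // q sq qp.
have qp0 x : q x <= p0 x := le_trans (qp x) (pp0 x).
by have /(congr1 sval) := pmin (exist P q (conj sq qp0)) (asboolT qp).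
Qed.

(* A minimal sublinear functional [p] equals [descent p x] for all [x], hence
   [p (- x) <= p (- x + x) - p x = - p x]. *)
Lemma hahn_banach p0 : sublinear p0 ->
  exists F : V -> R, [/\ forall x y, F (x + y) = F x + F y,
    forall t x, F (t%:C *: x) = t * F x & forall x, F x <= p0 x].
Proof.
move=> /sublinear_minimal[p [sp pp0 pmin]]; exists p.
have pN x : p (- x) = - p x.
  apply/eqP; rewrite eq_le; apply/andP; split; last first.
    by rewrite lerNl sublinearN_ge.
  have dp : descent p x = p.
    apply: pmin; first exact: descent_sublinear.
    move=> y; have := @descent_le p x y 0 sp (lexx 0).
    by rewrite scale0r addr0 mul0r subr0.
  have := @descent_le p x (- x) 1 sp ler01.
  by rewrite scale1r addNr sublinear0 // mul1r sub0r dp.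
split=> // [x y|t x].
  apply/eqP; rewrite eq_le sp.1 /=.
  by have := sp.1 (- x) (- y); rewrite -opprD !pN; lra.
have [t0|t0] := lerP 0 t; first exact: sublinearZ.
have := @sublinearZ p (- t) x sp; rewrite rmorphN scaleNr pN oppr_ge0 ltW //.
by move=> /(_ isT); lra.
Qed.

End Sublinear.

(** * Real parts of complex numbers *)

Lemma Re_add (R : rcfType) (z w : R[i]) :
  complex.Re (z + w) = complex.Re z + complex.Re w.
Proof. by case: z w => a b []. Qed.

Lemma Re_sub (R : rcfType) (z w : R[i]) :
  complex.Re (z - w) = complex.Re z - complex.Re w.
Proof. by case: z w => a b []. Qed.

Lemma Re_realM (R : rcfType) (r : R) (z : R[i]) :
  complex.Re (r%:C * z) = r * complex.Re z.
Proof. by case: z => a b /=; rewrite mul0r subr0. Qed.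

Lemma norm_le_Re (R : rcfType) (z : R[i]) :
  `|z| <= `|complex.Re z|%:C -> z = (complex.Re z)%:C.
Proof.
case: z => c d; rewrite normc_def lecR /= => cd.
have : c ^+ 2 + d ^+ 2 <= c ^+ 2.
  rewrite -[leLHS]sqr_sqrtr ?addr_ge0 ?sqr_ge0 //.
  by rewrite -[leRHS]real_normK ?num_real // lerXn2r ?nnegrE ?sqrtr_ge0.
rewrite gerDl => d2; have /eqP : d ^+ 2 == 0 by rewrite eq_le d2 sqr_ge0.
by move/eqP; rewrite sqrf_eq0 => /eqP ->.
Qed.

(** * Norming states, and reality of states on self-adjoint elements *)

Section States.
Variables (R : realType) (A : cstarAlgType R).
Implicit Types (x y h : A) (f : {scalar A}).

Lemma cnorm_sublinear : sublinear (@cnorm R A).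
Proof.
by split=> [x y|t x t0]; [exact: cnormD | rewrite cnormZr ger0_norm].
Qed.

(** Dominating [F] by [descent cnorm x] instead of the norm forces [F (- x) <= - |x|], so no
    extension from a subspace is needed. The complex functional is [F y - i F (i y)]; rotating its
    value onto the positive reals bounds its modulus by the norm. *)
Lemma norming_functional x : exists f : {scalar A},
  (forall y, `|f y| <= (cnorm y)%:C) /\ f x = (cnorm x)%:C.
Proof.
have sn := cnorm_sublinear.
have [F [FD FZ Fle]] := hahn_banach (descent_sublinear x sn).
have Fn y : F y <= cnorm y.
  apply: (le_trans (Fle y)); have := @descent_le _ _ _ x y 0 sn (lexx 0).
  by rewrite scale0r addr0 mul0r subr0.
have F0 : F 0 = 0 by have := FZ 0 0; rewrite scaler0 mul0r.
have FN y : F (- y) = - F y by apply/eqP; rewrite -addr_eq0 -FD addNr F0.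
have Fx : cnorm x <= F x.
  have := @descent_le _ _ _ x (- x) 1 sn ler01.
  rewrite scale1r addNr cnorm0 mul1r sub0r => /(le_trans (Fle _)).
  by rewrite FN lerN2.
pose f y := F y -i* F ('i *: y).
have FC c d y : F ((c +i* d) *: y) = c * F y + d * F ('i *: y).
  rewrite -!FZ -FD scalerA -scalerDl mulrC; congr (F (_ *: _)).
  exact: (complexE (c +i* d)).
have flin : scalar f.
  move=> [c d] y z; rewrite /f scalerDr !FD.
  rewrite (_ : 'i *: _ = (- d +i* c) *: y); last first.
    by rewrite scalerA; congr (_ *: _); simpc.
  rewrite (FC c d) (FC (- d) c); simpc; apply/eqP; rewrite eq_complex /=.
  by apply/andP; split; apply/eqP; ring.
have [g gE] : exists g : {scalar A}, forall y, complex.Re (g y) = F y.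
  pose fL := GRing.isLinear.Build R[i] A R[i] *%R f flin.
  by exists (HB.pack f fL : {scalar A}).
have gn y : `|g y| <= (cnorm y)%:C.
  have [->|gy0] := eqVneq (g y) 0; first by rewrite normr0 ler0c cnorm_ge0.
  pose z := `|g y| / g y.
  have z1 : `|z| = 1 by rewrite normrM normr_id normrV ?unitfE // divff ?normr_eq0.
  have <- : cnorm (z *: y) = cnorm y by rewrite cnormZ1.
  have -> : `|g y| = (complex.Re (g (z *: y)))%:C.
    by rewrite (linearZ_LR g) /= divfK // RRe_real ?normr_real.
  by rewrite lecR gE Fn.
exists g; split=> //.
have gx : complex.Re (g x) = cnorm x by apply/eqP; rewrite gE eq_le Fn Fx.
by rewrite -gx; apply: norm_le_Re; rewrite gx (ger0_norm (cnorm_ge0 x)).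
Qed.

Lemma state_of_bound f : f 1 = 1 -> (forall x, `|f x| <= (cnorm x)%:C) ->
  normalized_state f.
Proof.
move=> f1 fle; split=> //.
  apply: (@bounded_linear_continuous R[i] (normed_space A) R[i]^o f).
  apply/linear_boundedP; exists 1; split=> // r r1 x.
  apply: (le_trans (fle x)); rewrite -[leLHS]mul1r.
  by apply: ler_wpM2r; [rewrite ler0c cnorm_ge0 | exact: ltW].
apply/eqP; rewrite /dual_norm eq_le; apply/andP; split.
  apply: ge_sup.
    by exists (complex.Re `|f 0|), 0 => //=; rewrite cnorm0.
  by move=> _ [x x1 <-]; rewrite -lecR RRe_real ?normr_real // (le_trans (fle x)) // lecR.
apply: ub_le_sup; last by exists 1; [rewrite /= cnorm1 | rewrite f1 normr1].
exists 1 => _ [x x1 <-].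
by rewrite -lecR RRe_real ?normr_real // (le_trans (fle x)) // lecR.
Qed.

(* [dual_norm f = 1] excludes the junk value [0] of [sup], so the set is bounded. *)
Lemma state_le f x : normalized_state f -> `|f x| <= (cnorm x)%:C.
Proof.
move=> [_ _ fn].
have [|y0] := eqVneq (cnorm x) 0.
  by move=> /cnorm0_eq0 ->; rewrite linear0 normr0 cnorm0.
have x0 : 0 < cnorm x by rewrite lt_def y0 cnorm_ge0.
have bd : has_sup [set complex.Re `|f x| | x in [set x : A | cnorm x <= 1]].
  apply: contrapT => /sup_out fn0; move: fn; rewrite /dual_norm fn0 => /eqP.
  by rewrite eq_sym oner_eq0.
have := @ub_le_sup _ _ bd.2 (complex.Re `|f ((cnorm x)^-1%:C *: x)|).
rewrite [sup _]fn => fx.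
have {fx}: complex.Re `|f ((cnorm x)^-1%:C *: x)| <= 1.
  apply: fx; exists ((cnorm x)^-1%:C *: x) => //=.
  by rewrite cnormZr ger0_norm ?invr_ge0 ?mulVf // ltW.
rewrite -lecR RRe_real ?normr_real // (linearZ_LR f) normrM.
rewrite [`|_%:C|]ger0_norm ?ler0c ?invr_ge0 ?(ltW x0) //.
by rewrite fmorphV ler_pdivrMl ?ltcR // mulr1.
Qed.

Lemma state1 f : normalized_state f -> f 1 = 1.
Proof. by case. Qed.

Lemma state_norming h : selfadjoint h ->
  exists2 f, normalized_state f & f h = (cnorm h)%:C \/ f h = - (cnorm h)%:C.
Proof.
move=> sh; wlog hE : h sh / cnorm (1 + h) = 1 + cnorm h.
  move=> wl; case: (cnorm_1D_selfadjoint sh) => [|hE]; first exact: wl.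
  have [|f sf fh] := wl (- h) (selfadjointN sh); first by rewrite cnormN.
  exists f => //; move: fh; rewrite linearN cnormN => -[<-|/oppr_inj <-].
    by right; rewrite opprK.
  by left.
have [f [fle fE]] := norming_functional (1 + h).
have Re_le x : complex.Re (f x) <= cnorm x.
  rewrite -lecR (le_trans _ (fle x)) //; apply: le_trans (normc_ge_Re _).
  by rewrite lecR ler_norm.
(* The two real parts are at most [1] and [|h|] and add up to [1 + |h|], so both bounds are
   equalities; the modulus bounds then leave no imaginary parts. *)
have ReE : complex.Re (f 1) + complex.Re (f h) = 1 + cnorm h.
  by rewrite -Re_add -linearD fE hE.
have := Re_le 1; have := Re_le h; rewrite cnorm1 => fh1 f11.
have f1 : f 1 = 1.
  have R1 : complex.Re (f 1) = 1 by lra.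
  by rewrite (@norm_le_Re _ (f 1)) R1 // [`|1 : R|]normr1 -(@cnorm1 R A) fle.
exists f; first exact: state_of_bound.
have Rh : complex.Re (f h) = cnorm h by lra.
by left; rewrite (@norm_le_Re _ (f h)) Rh // (ger0_norm (cnorm_ge0 h)).
Qed.

(* [|f (h + i t)|^2 <= |h|^2 + t^2] for all real [t] forces [Im (f h) = 0]. *)
Lemma state_selfadjoint_real f h : normalized_state f -> selfadjoint h ->
  f h = (complex.Re (f h))%:C.
Proof.
move=> sf sh; case fhE: (f h) => [c d] /=; suff -> : d = 0 by [].
have bound t : (d + t) ^+ 2 <= cnorm h ^+ 2 + t ^+ 2.
  have sy : selfadjoint (t%:C *: (1 : A)) by exact/selfadjointZ/selfadjoint1.
  have hy : GRing.comm h (t%:C *: 1).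
    by rewrite /GRing.comm -scalerAr -scalerAl mulr1 mul1r.
  have := cnorm_cartesian_le sh sy hy.
  rewrite cnormZr cnorm1 mulr1 real_normK ?num_real //; apply: le_trans.
  have := state_le (h + 'i *: (t%:C *: 1)) sf.
  rewrite linearD scalerA (linearZ_LR f) state1 // mulr1 fhE normc_def lecR /=.
  rewrite !(mul0r, mulr0, mul1r, subr0, add0r, addr0) => le.
  rewrite (le_trans _ (lerXn2r 2 _ _ le)) ?nnegrE ?sqrtr_ge0 ?cnorm_ge0 //.
  by rewrite sqr_sqrtr ?addr_ge0 ?sqr_ge0 // lerDr sqr_ge0.
apply/eqP; apply: contraT => d0; have d2 : 0 < d ^+ 2 by rewrite exprn_even_gt0.
(* The bound reads [d^2 + 2 d t <= |h|^2]; this [t] makes [d t = |h|^2 + 1], which is too large. *)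
have := bound ((cnorm h ^+ 2 + 1) * d / d ^+ 2); set t := _ / _.
have td : d * t = cnorm h ^+ 2 + 1.
  by rewrite /t; field.
have := sqr_ge0 (cnorm h); nra.
Qed.

End States.

(** * Real and imaginary parts in the algebra, and positivity of states on squares *)

Section NumericalRangeTheory.
Variables (R : realType) (A : cstarAlgType R).
Implicit Types (a x y h : A) (f : {scalar A}) (k : R) (z : R[i]).

Lemma selfadjoint_Re x : selfadjoint (cstar_Re x).
Proof.
rewrite /selfadjoint /cstar_Re starZ starD starK addrC.
by rewrite conjc_inv conjc_nat.
Qed.

Lemma cstar_ReD x y : cstar_Re (x + y) = cstar_Re x + cstar_Re y.
Proof. by rewrite /cstar_Re starD addrACA scalerDr. Qed.

Lemma cstar_ReZr (r : R) x : cstar_Re (r%:C *: x) = r%:C *: cstar_Re x.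
Proof. by rewrite /cstar_Re starZr -scalerDr !scalerA mulrC. Qed.

Lemma cstar_ReN x : cstar_Re (- x) = - cstar_Re x.
Proof. by rewrite /cstar_Re starN -opprD scalerN. Qed.

(** Makes the imaginary part of [l a] the real part of another unimodular multiple of [a], so that
    bounds on all rotated real parts cover it. *)
Lemma cstar_ImE x : cstar_Im x = cstar_Re (- 'i *: x).
Proof.
rewrite /cstar_Im /cstar_Re starZ.
have -> : conjc (- 'i) = 'i :> R[i].
  by transitivity (- (Num.conj 'i : R[i])); [exact: rmorphN | rewrite conjCi opprK].
by rewrite invfM invCi -scalerA; congr (_ *: _); rewrite scalerBr !scaleNr opprK.
Qed.

Lemma selfadjoint_Im x : selfadjoint (cstar_Im x).
Proof. by rewrite cstar_ImE; exact: selfadjoint_Re. Qed.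

Lemma cartesian_decomp x : x = cstar_Re x + 'i *: cstar_Im x.
Proof.
rewrite /cstar_Re /cstar_Im scalerA invfM mulrCA mulfV ?neq0Ci // mulr1.
rewrite -scalerDr addrACA subrr addr0 -mulr2n -(scaler_nat 2 x) scalerA.
by rewrite mulVf ?scale1r ?pnatr_eq0.
Qed.

Lemma cnorm_Re_le x : cnorm (cstar_Re x) <= cnorm x.
Proof.
have -> : cstar_Re x = 2^-1%:C *: (x + star x) by rewrite fmorphV rmorph_nat.
have := cnormD x (star x); rewrite cnorm_star cnormZr.
by rewrite ger0_norm ?invr_ge0 //; lra.
Qed.

Lemma cstar_Re_cartesian x y : selfadjoint x -> selfadjoint y ->
  cstar_Re (x + 'i *: y) = x.
Proof.
move=> sx sy; rewrite /cstar_Re star_cartesian // addrACA subrr addr0 -mulr2n.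
by rewrite -(scaler_nat 2 x) scalerA mulVf ?scale1r ?pnatr_eq0.
Qed.

(* With [c = (1 - 2 s^2 h^2) + 2 i s h] one has [c^* c = 1 + 4 s^4 h^4], so
   [|1 - 2 s^2 h^2| <= |c| <= sqrt (1 + 4 s^4 |h|^4)]; then let [s] tend to [0]. *)
Lemma state_sqr_ge0 f h : normalized_state f -> selfadjoint h ->
  0 <= complex.Re (f (h ^+ 2)).
Proof.
move=> sf sh; rewrite leNgt; apply/negP; set F := complex.Re _ => F0.
have bound s : 1 - 2 * s ^+ 2 * F <= 0 \/
    (1 - 2 * s ^+ 2 * F) ^+ 2 <= 1 + 4 * s ^+ 4 * cnorm h ^+ 4.
  have sX : selfadjoint (1 - (2 * s ^+ 2)%:C *: h ^+ 2).
    by apply: selfadjointB; [exact: selfadjoint1 | exact/selfadjointZ/selfadjointX].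
  have sY : selfadjoint ((2 * s)%:C *: h) by exact: selfadjointZ.
  have XY : GRing.comm (1 - (2 * s ^+ 2)%:C *: h ^+ 2) ((2 * s)%:C *: h).
    rewrite /GRing.comm mulrBl mulrBr mul1r mulr1; congr (_ - _).
    by rewrite -!scalerAl -!scalerAr !scalerA mulrC -exprS -exprSr.
  have [|X0] := lerP (1 - 2 * s ^+ 2 * F) 0; [by left | right].
  have := cnorm_cartesian sX sY XY.
  have -> : (1 - (2 * s ^+ 2)%:C *: h ^+ 2) ^+ 2 + ((2 * s)%:C *: h) ^+ 2 =
      (4 * s ^+ 4)%:C *: h ^+ 4 + 1.
    rewrite -sqrrN opprB sqrrB1 !exprZn -!rmorphXn -exprM.
    have -> : (2 * s) ^+ 2 = (2 * s ^+ 2) *+ 2 by ring.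
    rewrite rmorphMn -scalerMnl addrAC subrK; congr (_%:C *: _ + _).
    ring.
  have := cnorm_Re_le (1 - (2 * s ^+ 2)%:C *: h ^+ 2 + 'i *: ((2 * s)%:C *: h)).
  rewrite cstar_Re_cartesian // => Xc cE.
  have -> : 4 * s ^+ 4 * cnorm h ^+ 4 = cnorm ((4 * s ^+ 4)%:C *: h ^+ 4).
    rewrite cnormZr cnormX_selfadjoint // ger0_norm //.
    by have := sqr_ge0 (s ^+ 2); rewrite -exprM; lra.
  have := cnormD ((4 * s ^+ 4)%:C *: h ^+ 4) 1; rewrite cnorm1 -cE [X in _ <= X]addrC.
  apply: le_trans; rewrite lerXn2r ?nnegrE ?cnorm_ge0 ?(ltW X0) //; apply: le_trans Xc.
  rewrite -lecR; apply: le_trans (state_le _ sf); apply: le_trans (normc_ge_Re _).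
  rewrite lecR; apply: le_trans (ler_norm _).
  by rewrite linearB state1 // (linearZ_LR f) Re_sub Re_realM.
have N4 : 0 <= cnorm h ^+ 4 by rewrite exprn_ge0 ?cnorm_ge0.
(* An explicit small value of [s^2]. The bound amounts to [- t F + t^2 F^2 <= t^2 |h|^4], whereas
   [- t F = t^2 (|h|^4 + 1)]. *)
pose t := - F / (cnorm h ^+ 4 + 1).
have t0 : 0 < t by rewrite divr_gt0 ?oppr_gt0 // ltr_wpDl.
have tE : t * (cnorm h ^+ 4 + 1) = - F by rewrite divfK // gt_eqF // ltr_wpDl.
have := bound (Num.sqrt t); rewrite -[(_ ^+ 4)]/(_ ^+ (2 * 2)) exprM.
rewrite sqr_sqrtr ?(ltW t0) // => -[]; first nra.
have : 0 < t ^+ 2 by rewrite exprn_gt0.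
have : 0 <= (t * F) ^+ 2 by exact: sqr_ge0.
nra.
Qed.

End NumericalRangeTheory.

(** * Rotations, the numerical radius, and convexity of the numerical range *)

Section NumericalRange.
Variables (R : realType) (A : cstarAlgType R).
Implicit Types (a x y h : A) (f g : {scalar A}) (k : R) (z w l : R[i]).

Lemma unit_rotation z : exists2 l, `|l| = 1 & l * z = `|z|.
Proof.
have [->|z0] := eqVneq z 0; first by exists 1; rewrite ?normr1 // mulr0 normr0.
exists (`|z| / z); last by rewrite divfK.
by rewrite normrM normr_id normrV ?unitfE // divff ?normr_eq0.
Qed.

Lemma expi_onto z : `|z| = 1 -> exists t, cos t +i* sin t = z.
Proof.
case: z => c d; rewrite normc_def /= => /complexI/(congr1 (fun r => r ^+ 2)).
rewrite sqr_sqrtr ?addr_ge0 ?sqr_ge0 // expr1n => cd.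
have c1 : -1 <= c <= 1 by apply/andP; have := sqr_ge0 d; split; nra.
have cosE : cos (acos c) = c by rewrite acosK // in_itv.
have sinE : sin (acos c) = `|d|.
  by rewrite sin_acos // (_ : 1 - c ^+ 2 = d ^+ 2) ?sqrtr_sqr //; lra.
have [d0|d0] := lerP 0 d.
  by exists (acos c); rewrite cosE sinE ger0_norm.
by exists (- acos c); rewrite cosN sinN cosE sinE ltr0_norm // opprK.
Qed.

Lemma norm_expi (t : R) : `|cos t +i* sin t| = 1.
Proof. by rewrite normc_def /= cos2Dsin2 sqrtr1. Qed.

(** Since [f] is real on self-adjoint elements, it maps the Cartesian decomposition of [x] to that
    of [f x]. *)
Lemma state_Re f x : normalized_state f -> f (cstar_Re x) = (complex.Re (f x))%:C.
Proof.
move=> sf; have -> : f x = f (cstar_Re x) + 'i * f (cstar_Im x).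
  by rewrite {1}(cartesian_decomp x) linearD (linearZ_LR f 'i).
rewrite (state_selfadjoint_real sf (selfadjoint_Re x)).
rewrite (state_selfadjoint_real sf (selfadjoint_Im x)).
by rewrite Re_add ['i * _]mulrC Re_realM [_ * complex.Re 'i]mulr0 addr0.
Qed.

Lemma exists_normalized_state : exists f : {scalar A}, normalized_state f.
Proof. by have [f sf _] := state_norming (selfadjoint1 A); exists f. Qed.

Lemma num_radius_ge a f : normalized_state f -> `|f a| <= (num_radius a)%:C.
Proof.
move=> sf; rewrite -[`|f a|]RRe_real ?normr_real // lecR; apply: ub_le_sup.
  exists (cnorm a) => _ [g sg <-].
  by rewrite -lecR RRe_real ?normr_real // state_le.
by exists f.
Qed.

Lemma num_radius_le a k :
  (forall f, normalized_state f -> `|f a| <= k%:C) -> num_radius a <= k.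
Proof.
move=> ak; apply: ge_sup.
  by have [f sf] := exists_normalized_state; exists (complex.Re `|f a|), f.
by move=> _ [f sf <-]; rewrite -lecR RRe_real ?normr_real // ak.
Qed.

(** A state norming the real part of [l a] takes there the value [Re (l f(a))], of modulus at most
    [|f a|]. *)
Lemma cnorm_Re_le_num_radius a l : `|l| = 1 ->
  cnorm (cstar_Re (l *: a)) <= num_radius a.
Proof.
move=> l1; have [f sf fE] := state_norming (selfadjoint_Re (l *: a)).
have {fE} : `|f (cstar_Re (l *: a))| = (cnorm (cstar_Re (l *: a)))%:C.
  by case: fE => ->; rewrite ?normrN ger0_norm ?ler0c ?cnorm_ge0.
rewrite state_Re // => fE; rewrite -lecR -fE normc_def /= expr0n addr0 sqrtr_sqr.
apply: (le_trans (normc_ge_Re _)); rewrite (linearZ_LR f) normrM l1 mul1r.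
exact: num_radius_ge.
Qed.

(** If [l] rotates [f a] to a nonnegative real, then [|f a|] is the value of [f] at the real part of
    [l a]. *)
Lemma state_le_Re a k f : normalized_state f ->
  (forall l, `|l| = 1 -> cnorm (cstar_Re (l *: a)) <= k) -> `|f a| <= k%:C.
Proof.
move=> sf ak; have [l l1 lE] := unit_rotation (f a).
have := ak l l1; rewrite -lecR; apply: le_trans.
apply: le_trans (state_le _ sf); rewrite state_Re // (linearZ_LR f) /= lE.
rewrite RRe_real ?normr_real // normr_id //.
Qed.

(** With [u = i q], the mixed terms of [(p - u) (p + u) + (p + u) (p - u)] cancel, leaving
    [2 (p^2 - u^2)]. *)
Lemma Re_sqrD_Im_sqr x :
  cstar_Re x ^+ 2 + cstar_Im x ^+ 2 = 2^-1 *: (star x * x + x * star x).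
Proof.
set p := cstar_Re x; set q := cstar_Im x.
have -> : star x = p - 'i *: q.
  rewrite {1}(cartesian_decomp x) star_cartesian //; first exact: selfadjoint_Re.
  exact: selfadjoint_Im.
rewrite [in LHS](_ : q ^+ 2 = - ('i *: q) ^+ 2); last first.
  by rewrite (exprZn 'i) sqrCi scaleN1r opprK.
rewrite [in RHS](cartesian_decomp x) -/p -/q; set u := 'i *: q.
rewrite mulrDr mulrBr addrACA -mulrDl -mulrBl addrACA addNr addr0 opprD addrACA.
rewrite subrr add0r -opprD -!mulr2n mulNr !mulrnAl -mulrnBl -(scaler_nat 2 (_ - _)).
by rewrite scalerA mulVf ?scale1r ?pnatr_eq0.
Qed.

Lemma num_range_convex a (r : R) z w : 0 <= r <= 1 ->
  num_range a z -> num_range a w -> num_range a (r%:C * z + (1 - r)%:C * w).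
Proof.
move=> /andP[r0 r1] [f sf <-] [g sg <-].
pose c x := r%:C * f x + (1 - r)%:C * g x.
have clin : scalar c.
  by move=> z' x y; rewrite /c !linearP /=; ring.
have [u uE] : exists u : {scalar A}, forall y, u y = c y.
  pose cL := GRing.isLinear.Build R[i] A R[i] *%R c clin.
  by exists (HB.pack c cL : {scalar A}).
exists u; last by rewrite uE.
apply: state_of_bound.
  by rewrite uE /c !state1 // !mulr1 -rmorphD addrC subrK.
move=> x; rewrite uE; apply: (le_trans (ler_normD _ _)); rewrite !normrM.
have -> : (cnorm x)%:C = r%:C * (cnorm x)%:C + (1 - r)%:C * (cnorm x)%:C.
  by rewrite -mulrDl -rmorphD addrC subrK mul1r.
rewrite [`|r%:C|]ger0_norm ?ler0c // [`|(1 - r)%:C|]ger0_norm ?ler0c ?subr_ge0 //.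
by rewrite lerD // ler_wpM2l ?ler0c ?subr_ge0 ?state_le.
Qed.

(* A point of the half disk lies on a chord orthogonal to its axis of symmetry,
   whose endpoints lie on the half circle. *)
Lemma semidisk_sub a t k : 0 <= k ->
  (forall w, `|w| = k%:C -> 0 <= complex.Re ((cos t +i* sin t) * w) ->
     num_range a w) ->
  semidisk t k `<=` num_range a.
Proof.
move=> k0 arc w [wk]; set e := cos t +i* sin t => ew.
have e1 : `|e| = 1 := norm_expi t.
have ee : conjc e * e = 1 by rewrite mulrC -sqr_normc e1 expr1n.
(* Rotating by [e] turns the half disk into [x >= 0]; the vertical chord through [x + i y] then has
   half-length [s] below. *)
have {ew} [x [y [wE x0 xy]]] : exists x y : R,
    [/\ w = conjc e * (x +i* y), 0 <= x & x ^+ 2 + y ^+ 2 <= k ^+ 2].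
  case ewE: (e * w) ew => [x y] x0; exists x, y; split=> //.
    by rewrite -ewE mulrA ee mul1r.
  rewrite -lecR -[x]/(complex.Re (x +i* y)) -[y]/(complex.Im (x +i* y)).
  rewrite add_Re2_Im2 -ewE normrM e1 mul1r rmorphXn lerXn2r ?nnegrE //.
  by rewrite ler0c.
pose s := Num.sqrt (k ^+ 2 - x ^+ 2).
have s2 : s ^+ 2 = k ^+ 2 - x ^+ 2 by rewrite sqr_sqrtr //; have := sqr_ge0 y; lra.
have s0 : 0 <= s := sqrtr_ge0 _.
have end_in d : d ^+ 2 = s ^+ 2 -> num_range a (conjc e * (x +i* d)).
  move=> ds; apply: arc.
    rewrite normrM normcJ e1 mul1r normc_def /= ds s2 addrC subrK sqrtr_sqr.
    by rewrite ger0_norm.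
  by rewrite mulrA [e * _]mulrC ee mul1r.
have ys : y ^+ 2 <= s ^+ 2 by lra.
(* A chord reduced to a point is treated apart, because the weight [r] divides by its length. *)
have [s00|sn0] := eqVneq s 0.
  rewrite wE; apply: end_in; apply/eqP; rewrite eq_le ys s00 expr0n /=.
  exact: sqr_ge0.
have {sn0}sp : 0 < s by rewrite lt_def sn0.
have /andP[ys1 ys2] : - s <= y <= s.
  by rewrite -ler_norml -(@ler_pXn2r _ 2) ?nnegrE // real_normK ?num_real.
pose r := (y + s) / (2 * s).
have rE : r * (2 * s) = y + s by rewrite divfK //; apply/eqP; lra.
have r01 : 0 <= r <= 1.
  rewrite /r divr_ge0 ?ler_pdivrMr ?mulr_gt0 ?mul1r //=; lra.
have := num_range_convex r01 (end_in s (erefl _)) (end_in (- s) (sqrrN _)).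
congr (num_range a _); rewrite wE !(mulrCA (_%:C)) -mulrDr.
congr (_ * _); simpc; apply/eqP; rewrite eq_complex /=; apply/andP.
by split; apply/eqP; [ring | rewrite mulrBl; lra].
Qed.

End NumericalRange.

(** * The numerical range when all rotated real parts have norm [k] *)

Section Characterization.
Variables (R : realType) (A : cstarAlgType R).
Implicit Types (a x y h : A) (f : {scalar A}) (k : R) (z w l : R[i]).

Lemma state_Re_bound f x : normalized_state f ->
  - cnorm x <= complex.Re (f x) <= cnorm x.
Proof.
move=> sf; rewrite -ler_norml -lecR.
exact: le_trans (normc_ge_Re _) (state_le x sf).
Qed.

(** The unimodular factor cancels in both products. This lets one norming state serve all
    rotations. *)
Lemma Re_sqr_rotation a l : `|l| = 1 ->
  cstar_Re (l *: a) ^+ 2 + cstar_Im (l *: a) ^+ 2 =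
  2^-1 *: (star a * a + a * star a).
Proof.
move=> l1; rewrite Re_sqrD_Im_sqr starZ -!scalerAl -!scalerAr !scalerA.
by rewrite [_ * l]mulrC -sqr_normc l1 expr1n !scale1r.
Qed.

Lemma cnorm_Im_rotation a k l : (forall l, `|l| = 1 -> cnorm (cstar_Re (l *: a)) = k) ->
  `|l| = 1 -> cnorm (cstar_Im (l *: a)) = k.
Proof.
by move=> ak l1; rewrite cstar_ImE scalerA ak // normrM l1 normrN normCi mulr1.
Qed.

(* Take [f0] norming [h^2 + g^2 = (a^* a + a a^* ) / 2], where [h] and [g] are the
   real and imaginary part of [l a]: since [|h| = |g| = k], equality is forced
   in [f0 (h^2) + f0 (g^2) <= 2 k^2]. *)
Lemma state_Re_sqr a k : 0 <= k ->
  cnorm (star a * a + a * star a) = 4 * k ^+ 2 ->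
  (forall l, `|l| = 1 -> cnorm (cstar_Re (l *: a)) = k) ->
  exists2 f0, normalized_state f0 & forall l, `|l| = 1 ->
    complex.Re (f0 (cstar_Re (l *: a) ^+ 2)) = k ^+ 2.
Proof.
move=> k0 aK ak; set S := 2^-1 *: (star a * a + a * star a).
have sS : selfadjoint S.
  rewrite /S -(Re_sqr_rotation a (normr1 _)).
  apply: selfadjointD; apply: selfadjointX; first exact: selfadjoint_Re.
  exact: selfadjoint_Im.
have cS : cnorm S = 2 * k ^+ 2.
  rewrite /S -(rmorph_nat (real_complex R)) -fmorphV cnormZr aK.
  by rewrite ger0_norm ?invr_ge0 //; lra.
have [f0 sf0 f0S] := state_norming sS; exists f0 => // l l1.
have sh := selfadjoint_Re (l *: a); have sg := selfadjoint_Im (l *: a).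
have := state_sqr_ge0 sf0 sh; have := state_sqr_ge0 sf0 sg.
have := state_Re_bound (cstar_Re (l *: a) ^+ 2) sf0.
have := state_Re_bound (cstar_Im (l *: a) ^+ 2) sf0.
rewrite !cnorm_sqr // ak // (cnorm_Im_rotation ak) //.
have : complex.Re (f0 S) = complex.Re (f0 (cstar_Re (l *: a) ^+ 2)) +
    complex.Re (f0 (cstar_Im (l *: a) ^+ 2)).
  by rewrite -Re_add -linearD Re_sqr_rotation.
(* Norming determines [f0 S] only up to sign. As a sum of two nonnegative terms it can be [- 2 k^2]
   only if [k = 0], where the claim still holds. *)
have : complex.Re (f0 S) = 2 * k ^+ 2 \/ complex.Re (f0 S) = - (2 * k ^+ 2).
  by rewrite -cS; case: f0S => ->; [left | right].
by have := sqr_ge0 k; lra.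
Qed.

(* If [m = |k + h| < 2 k], put [d = 2 k - m]: the states take values in
   [-k, k - d] at [h], so [|h + d / 2| <= k - d / 2], that is
   [f0 ((h + d / 2)^2) <= (k - d / 2)^2]. *)
Lemma state_attains h k f0 : selfadjoint h -> cnorm h = k ->
  normalized_state f0 -> complex.Re (f0 (h ^+ 2)) = k ^+ 2 ->
  (exists2 f, normalized_state f & complex.Re (f h) = k) \/
  complex.Re (f0 h) = - k.
Proof.
move=> sh hk sf0 f0h.
have s1 c : selfadjoint (c%:C *: (1 : A)) by exact/selfadjointZ/selfadjoint1.
have sD c : selfadjoint (h + c%:C *: 1) by exact: selfadjointD.
have fD f c : normalized_state f -> complex.Re (f (h + c%:C *: 1)) = complex.Re (f h) + c.
  by move=> sf; rewrite linearD (linearZ_LR f) state1 // Re_add mulr1.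
have norming c : exists2 f, normalized_state f &
    complex.Re (f h) + c = cnorm (h + c%:C *: 1) \/
    complex.Re (f h) + c = - cnorm (h + c%:C *: 1).
  have [f sf fE] := state_norming (sD c); exists f; rewrite // -fD //.
  by case: fE => ->; [left | right].
have k0 : 0 <= k by rewrite -hk cnorm_ge0.
have [f sf fE] := norming k; have := state_Re_bound h sf; rewrite hk => fh.
set m := cnorm _ in fE; have mk : m <= 2 * k.
  apply: (le_trans (cnormD _ _)); rewrite cnormZr cnorm1 hk ger0_norm //; lra.
have [m2k|mn2k] := eqVneq m (2 * k).
  by left; exists f => //; case: fE; lra.
right; have {mn2k}mk2 : m < 2 * k by rewrite lt_neqAle mn2k.
pose d := 2 * k - m; have dE : m = 2 * k - d by rewrite /d; ring.
have {}mk2 : 0 < d by rewrite subr_gt0.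
have y_le : cnorm (h + (d / 2)%:C *: 1) <= k - d / 2.
  have [g sg gE] := norming (d / 2).
  have := state_Re_bound h sg; rewrite hk.
  have := state_Re_bound (h + k%:C *: 1) sg; rewrite fD // -/m dE.
  by case: gE; lra.
have sqrD c : (h + c%:C *: 1) ^+ 2 = h ^+ 2 + (c + c)%:C *: h + (c ^+ 2)%:C *: 1.
  have hc : h * (c%:C *: 1) = c%:C *: h by rewrite -scalerAr mulr1.
  have ch x : (c%:C *: 1) * x = c%:C *: x by rewrite -scalerAl mul1r.
  by rewrite expr2 mulrDl !mulrDr hc !ch scalerA -rmorphM -!expr2 rmorphD scalerDl !addrA.
have : complex.Re (f0 ((h + (d / 2)%:C *: 1) ^+ 2)) =
    k ^+ 2 + d * complex.Re (f0 h) + (d / 2) ^+ 2.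
  have linE u v : f0 (h ^+ 2 + u%:C *: h + v%:C *: 1) =
      f0 (h ^+ 2) + u%:C * f0 h + v%:C * f0 1.
    by rewrite 2!linearD (linearZ_LR f0 _ h) (linearZ_LR f0 _ 1).
  rewrite sqrD -splitr linE !Re_add !Re_realM state1 // f0h.
  by rewrite [_ * complex.Re 1]mulr1.
have := state_Re_bound ((h + (d / 2)%:C *: 1) ^+ 2) sf0.
rewrite cnorm_sqr // => /andP[_ le1] eq1.
have le2 : cnorm (h + (d / 2)%:C *: 1) ^+ 2 <= (k - d / 2) ^+ 2.
  by rewrite lerXn2r ?nnegrE ?cnorm_ge0 // (le_trans (cnorm_ge0 _) y_le).
have := state_Re_bound h sf0; rewrite hk => /andP[f0ge _].
(* Comparing [k^2 + d f0(h) + d^2 / 4] with [(k - d / 2)^2] leaves [d f0(h) <= - d k], and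
   [d > 0]. *)
apply/eqP; rewrite eq_le f0ge andbT -(ler_pM2l mk2).
by move: le1; rewrite eq1; nra.
Qed.

(* By [state_attains], every [w] of modulus [k] other than [- f0 a] belongs to
   the numerical range, so any half disk containing [f0 a] on its axis works. *)
Lemma semidisk_num_range a k : 0 <= k ->
  cnorm (star a * a + a * star a) = 4 * k ^+ 2 ->
  (forall l, `|l| = 1 -> cnorm (cstar_Re (l *: a)) = k) ->
  exists t, semidisk t k `<=` num_range a /\ num_range a `<=` disk k.
Proof.
move=> k0 aK ak.
have fk f : normalized_state f -> `|f a| <= k%:C.
  by move=> sf; apply: state_le_Re => // l l1; rewrite ak.
have [f0 sf0 f0k] := state_Re_sqr k0 aK ak.
have [e e1 eE] := unit_rotation (f0 a); have [t tE] := expi_onto e1.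
exists t; split; last by move=> _ [f sf <-]; exact: fk.
apply: semidisk_sub => // w wk; rewrite tE => ew.
have [w0|wn0] := eqVneq w 0.
  exists f0 => //; apply/eqP; rewrite w0 -normr_le0.
  by apply: le_trans (fk _ sf0) _; rewrite -wk w0 normr0.
have kn0 : k%:C != 0 by rewrite -wk normr_eq0.
(* Chosen so that [l w = k]: a state with real part [k] at [l a] must have [l f(a) = k], hence
   [f a = w]. *)
pose l := k%:C / w; have l1 : `|l| = 1.
  by rewrite normrM normrV ?unitfE // wk ger0_norm ?ler0c // divff.
have unique f : normalized_state f -> forall r : R, `|r| = k ->
    complex.Re (f (cstar_Re (l *: a))) = r -> f a = r%:C / k%:C * w.
  move=> sf r rk; rewrite state_Re //= => fr.
  have lfr : l * f a = r%:C.
    rewrite -fr -(linearZ_LR f); apply: norm_le_Re; rewrite fr rk.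
    by rewrite (linearZ_LR f) normrM l1 mul1r fk.
  by rewrite -lfr /l; field; rewrite kn0 wn0.
have [[f sf fE]|f0E] := state_attains (selfadjoint_Re _) (ak l l1) sf0 (f0k l l1).
  by exists f => //; rewrite (unique f sf k) ?ger0_norm // divff ?mul1r.
(* Since [e] rotates [f0 a] onto the nonnegative reals, [f0 a = - w] would put [e w] at [- k],
   outside the closed half plane unless [k = 0]. *)
have f0a : f0 a = - w.
  by rewrite (unique f0 sf0 (- k)) ?normrN ?ger0_norm // rmorphN mulNr divff ?mulN1r.
have ewE : e * w = - k%:C by rewrite -wk -normrN -f0a -eE f0a mulrN opprK.
have {}k0 : k = 0 by move: ew; rewrite ewE /=; lra.
by rewrite k0 eqxx in kn0.
Qed.

End Characterization.

Theorem proposition2p12 (R : realType) (A : cstarAlgType R) (a : A) :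
  [<->
    (* (i) *)
    num_radius a = Num.sqrt (4^-1 * cnorm (star a * a + a * star a));
    (* (ii) *)
    forall l : R[i], `|l| = 1 ->
      cnorm (cstar_Re (l *: a)) = cnorm (cstar_Im (l *: a)) /\
      cnorm (cstar_Im (l *: a))
        = Num.sqrt (4^-1 * cnorm (star a * a + a * star a));
    (* (iii) *)
    forall l : R[i], `|l| = 1 ->
      cnorm (cstar_Re (l *: a) + cstar_Im (l *: a))
        = cnorm (cstar_Re (l *: a) - cstar_Im (l *: a)) /\
      cnorm (cstar_Re (l *: a) - cstar_Im (l *: a))
        = Num.sqrt (2^-1 * cnorm (star a * a + a * star a));
    (* (iv) *)
    let k := 2^-1 * Num.sqrt (cnorm (star a * a + a * star a)) in
    exists t : R,
      semidisk t k `<=` num_range a /\ num_range a `<=` disk k ].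
Proof.
set K := cnorm (star a * a + a * star a).
have K0 : 0 <= K := cnorm_ge0 _.
pose k := 2^-1 * Num.sqrt K.
have k0 : 0 <= k by rewrite mulr_ge0 ?invr_ge0 // sqrtr_ge0.
have Kk : K = 4 * k ^+ 2.
  by rewrite /k exprMn sqr_sqrtr // exprVn mulrA -natrX mulfV ?mul1r ?pnatr_eq0.
have -> : Num.sqrt (4^-1 * K) = k.
  by rewrite Kk mulrA mulVf ?pnatr_eq0 // mul1r sqrtr_sqr ger0_norm.
have -> : Num.sqrt (2^-1 * K) = Num.sqrt 2 * k.
  rewrite Kk (_ : 2^-1 * _ = 2 * k ^+ 2); last by field.
  by rewrite sqrtrM // sqrtr_sqr ger0_norm.
pose s : R := Num.sqrt 2.
have s0 : 0 < s by rewrite sqrtr_gt0.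
have s2 : s ^+ 2 = 2 by rewrite sqr_sqrtr.
(* [w] is [exp (- i pi / 4)], that is [(1 - i) / sqrt 2] *)
pose w : R[i] := s^-1 -i* s^-1.
have w1 : `|w| = 1.
  by rewrite normc_def /= sqrrN exprVn s2 (_ : _ + _ = 1) ?sqrtr1 //; lra.
have ss : s * s^-1 = 1 by rewrite mulfV // gt_eqF.
(* The sum is the real part of [(1 - i) x], and [1 - i = s w]; the difference likewise involves
   [1 + i], the conjugate. *)
have addE x : cstar_Re x + cstar_Im x = s%:C *: cstar_Re (w *: x).
  rewrite cstar_ImE -cstar_ReD -cstar_ReZr scalerA -{1}(scale1r x) -scalerDl.
  congr (cstar_Re (_ *: _)); rewrite /w; simpc.
  by apply/eqP; rewrite eq_complex /= ss ?subr0 ?addr0 ?add0r ?sub0r !eqxx.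
have subE x : cstar_Re x - cstar_Im x = s%:C *: cstar_Re (conjc w *: x).
  rewrite cstar_ImE -cstar_ReN -cstar_ReD -cstar_ReZr scalerA -scaleNr opprK.
  rewrite -{1}(scale1r x) -scalerDl; congr (cstar_Re (_ *: _)); rewrite /w; simpc.
  by apply/eqP; rewrite eq_complex /= ss ?subr0 ?addr0 ?add0r ?sub0r !eqxx.
tfae.
- move=> ak l l1.
  have le_k z : `|z| = 1 -> cnorm (cstar_Re (z *: a)) <= k.
    by rewrite -ak; exact: cnorm_Re_le_num_radius.
  have Re_l := le_k _ l1.
  have Im_l : cnorm (cstar_Im (l *: a)) <= k.
    by rewrite cstar_ImE scalerA le_k // normrM l1 normrN normCi mulr1.
  (* Here [2 k^2 = |h^2 + g^2| <= |h|^2 + |g|^2 <= 2 k^2] for the real and imaginary parts [h], [g]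
     of [l a], so both norms equal [k]. *)
  have := cnormD (cstar_Re (l *: a) ^+ 2) (cstar_Im (l *: a) ^+ 2).
  rewrite Re_sqr_rotation // -(rmorph_nat (real_complex R)) -fmorphV cnormZr.
  rewrite ger0_norm ?invr_ge0 // -/K Kk.
  rewrite !cnorm_sqr; [|exact: selfadjoint_Im|exact: selfadjoint_Re].
  have := cnorm_ge0 (cstar_Re (l *: a)); have := cnorm_ge0 (cstar_Im (l *: a)).
  move: Re_l Im_l; set x := cnorm _; set y := cnorm _ => xk yk x0 y0 xy.
  have x2 : x ^+ 2 <= k ^+ 2 by rewrite lerXn2r ?nnegrE.
  have y2 : y ^+ 2 <= k ^+ 2 by rewrite lerXn2r ?nnegrE.
  have -> : x = k by apply/eqP; rewrite -(@eqrXn2 _ 2) //; apply/eqP; lra.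
  by have -> : y = k by apply/eqP; rewrite -(@eqrXn2 _ 2) //; apply/eqP; lra.
- move=> ak l l1; rewrite addE subE !cnormZr !ger0_norm ?(ltW s0) //.
  rewrite !scalerA; have Re_k z : `|z| = 1 -> cnorm (cstar_Re (z *: a)) = k.
    by move=> /ak[-> ->].
  by rewrite !Re_k ?normrM ?normcJ ?w1 ?l1 ?mulr1.
- move=> ak; apply: semidisk_num_range => // l l1.
  (* At the point [w l], the difference in (iii) is [s] times the real part of [l a], since [w]
     times its conjugate is 1. *)
  have wl1 : `|w * l| = 1 by rewrite normrM w1 l1 mulr1.
  have [_] := ak _ wl1; rewrite subE cnormZr (ger0_norm (ltW s0)).
  rewrite scalerA mulrA [w^*%C * w]mulrC.
  by rewrite -sqr_normc w1 expr1n mul1r => /(mulfI (lt0r_neq0 s0)).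
- move=> [t [semi full]]; apply/eqP; rewrite eq_le; apply/andP; split.
    by apply: num_radius_le => f sf; apply: full; exists f.
  have e1 : `|cos t +i* sin t| = 1 :> R[i] := norm_expi t.
  (* The midpoint of the half disk's arc, a point of modulus [k] in the numerical range. *)
  have [|f sf fE] := semi (k%:C * conjc (cos t +i* sin t)).
    split; first by rewrite normrM normcJ e1 mulr1 ger0_norm ?ler0c.
    by rewrite mulrCA -sqr_normc e1 expr1n mulr1.
  have := num_radius_ge a sf; rewrite fE normrM normcJ e1 mulr1 ger0_norm ?ler0c //.
  by rewrite lecR.
Qed.
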